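(* Let $G$ be a group and let $M$ be an object of the topos $G\text{-}Set$. For each integer $n\geq 1$ let $M_n:=\underbrace{P(\dots(P}_{n\text{ times}}(M)))$ be the $n$-fold iterated power object of $M$ in $G\text{-}Set$. Then an object $X$ of $G\text{-}Set$ is isomorphic in $G\text{-}Set$ to some subobject of one of the objects $M_n$ $(n\geq 1)$ if and only if both of the following conditions hold: (1) $\operatorname{card} X<\chi(M):=\sup\{\operatorname{card} M,\operatorname{card} P(M),\operatorname{card} P(P(M)),\dots\}$, and (2) $\{g\in G:\forall m\in M\ gm=m\}\subseteq\{g\in G:\forall x\in X\ gx=x\}$.
   Context: For a group $G$, $G\text{-}Set$ is the category whose objects are sets equipped with a (left) $G$-action and whose morphisms are the functions preserving this action; it is an elementary topos. $P:G\text{-}Set\to G\text{-}Set$ denotes the power functor: for a $G$-set $A$, the power object $P(A)$ is the set of all subsets of $A$ with the $G$-action $gS=\{gs:s\in S\}$ for $g\in G$, $S\subseteq A$. A subobject of a $G$-set is a $G$-invariant subset with the restricted action. $\operatorname{card}$ denotes the cardinality of the underlying set, and the supremum is taken in the class of cardinal numbers. *)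

(* Defs.v *)
From mathcomp Require Import all_boot.
From mathcomp Require Import boolp classical_sets functions cardinality.

Set Implicit Arguments.
Unset Strict Implicit.
Unset Printing Implicit Defensive.

Local Open Scope classical_set_scope.
Local Open Scope card_scope.

(* Cardinal numbers are represented by types up to equipotence. *)

Definition card_lt (X Y : Type) : Prop :=
  ([set: X] #<= [set: Y]) /\ ~ ([set: X] #= [set: Y]).

Definition is_card_sup (F : nat -> Type) (S : Type) : Prop :=
  (forall n, [set: F n] #<= [set: S]) /\
  (forall T : Type, (forall n, [set: F n] #<= [set: T]) ->
     [set: S] #<= [set: T]).

Lemma inj_card_leT (T U : Type) (f : T -> U) :
  injective f -> [set: T] #<= [set: U].
Proof.
move=> fI; rewrite -(card_le_eql (inj_card_eq (in2W fI))); exact: card_leT.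
Qed.

(* A nonempty family of cardinals has a least element: take a maximal set of
   elements of the product on which every coordinate is injective; some
   coordinate must be onto. *)
Lemma card_family_min (I : Type) (i0 : I) (X : I -> Type) :
  exists i, forall j, [set: X i] #<= [set: X j].
Proof.
pose P (Z : set (forall i, X i)) :=
  forall f g, Z f -> Z g -> forall i, f i = g i -> f = g.
have [F FP Ftot|Z [ZP Zmax]] := @Zorn_bigcup _ P.
  move=> f g [A FA Af] [B FB Bg].
  by have [AB|BA] := Ftot _ _ FA FB;
    [apply: (FP _ FB) => //; exact: AB | apply: (FP _ FA) => //; exact: BA].
suff [i Hi] : exists i, forall x : X i, exists f, Z f /\ f i = x.
  exists i => j; have [s sP] := choice Hi.
  apply: (@inj_card_leT _ _ (fun x => s x j)) => x y /= sxy.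
  have [[Zx <-] [Zy <-]] := (sP x, sP y).
  by rewrite (ZP _ _ Zx Zy j sxy).
apply: contrapT => /forallNP noi.
have miss i : {x : X i | forall f, Z f -> f i <> x}.
  apply: cid; have /existsNP[x xP] := noi i.
  by exists x => f Zf fx; apply: xP; exists f.
pose h i := sval (miss i).
have hP i f : Z f -> f i <> h i by exact: (svalP (miss i)).
apply: (Zmax (Z `|` [set h])).
  split; first by move=> f; left.
  by move=> /(_ h (or_intror erefl)) /(hP i0); apply.
move=> f g [Zf|->] [Zg|->] i //; first exact: ZP.
- by move/(hP i _ Zf).
- by move/esym/(hP i _ Zg).
Qed.

Lemma card_le_or (X Y : Type) :
  [set: X] #<= [set: Y] \/ [set: Y] #<= [set: X].
Proof.
have [[] H] := card_family_min true (fun b : bool => if b then X else Y).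
- by left; exact: (H false).
- by right; exact: (H true).
Qed.

(* Suprema of sequences of cardinals exist; a representative is found among
   the subsets of the disjoint union. *)
Lemma card_sup_subproof (F : nat -> Type) :
  exists A : set {n & F n}, is_card_sup F (set_type A).
Proof.
pose W := {n & F n}.
pose ub (A : set W) := forall n, [set: F n] #<= A.
have ubT : ub setT.
  by move=> n; apply: (@inj_card_leT _ _ (existT F n)) => x y; apply: existT_inj2.
have [[A Aub] Amin] :=
  @card_family_min {A : set W | ub A} (exist _ setT ubT) (fun B => set_type (sval B)).
exists A; split=> [n|T Tub]; first by rewrite (card_le_eqr (card_setT _)).
have [//|] := card_le_or (set_type A) T.
move=> TA; have /card_subP[C CT _] : [set: T] #<= [set: W].
  by apply: card_le_trans TA _; rewrite (card_le_eql (card_setT _)) card_leT.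
have Cub : ub C by move=> n; rewrite (card_le_eqr CT).
have := Amin (exist _ C Cub); rewrite /= => AC.
by apply: card_le_trans AC _; rewrite (card_le_eql (card_setT _))
  (card_le_eql CT) card_lexx.
Qed.

Definition card_sup (F : nat -> Type) : Type :=
  set_type (sval (cid (card_sup_subproof F))).

Lemma card_supP (F : nat -> Type) : is_card_sup F (card_sup F).
Proof. exact: svalP (cid (card_sup_subproof F)). Qed.

Record gset (G : groupType) := GSet {
  gcarrier :> Type;
  gact : G -> gcarrier -> gcarrier;
  gact1 : forall x, gact 1%g x = x;
  gactM : forall g h x, gact (g * h)%g x = gact g (gact h x) }.

Definition equivariant (G : groupType) (A B : gset G) (f : A -> B) : Prop :=
  forall g x, f (gact g x) = gact g (f x).

Definition gset_iso (G : groupType) (A B : gset G) : Prop :=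
  exists (f : A -> B) (f' : B -> A),
    [/\ equivariant f, equivariant f', cancel f f' & cancel f' f].

Section Power.
Variables (G : groupType) (A : gset G).

Let pact (g : G) (S : set A) : set A := gact g @` S.

Let pact1 S : pact 1%g S = S.
Proof. by rewrite /pact; under eq_imagel do rewrite gact1; rewrite image_id. Qed.

Let pactM g h S : pact (g * h)%g S = pact g (pact h S).
Proof. by rewrite /pact image_comp; apply: eq_imagel => x _ /=; rewrite gactM. Qed.

Definition gpower : gset G := GSet pact1 pactM.

End Power.

Definition gpower_iter (G : groupType) (n : nat) (M : gset G) : gset G :=
  iter n (@gpower G) M.

Definition ginvariant (G : groupType) (A : gset G) (S : set A) : Prop :=
  forall g x, S x -> S (gact g x).

Section Subobject.
Variables (G : groupType) (A : gset G) (S : set A) (Sinv : ginvariant S).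

Let sact (g : G) (x : set_type S) : set_type S :=
  SigSub (mem_set (Sinv g (set_valP x))).

Let sact1 x : sact 1%g x = x.
Proof. by apply: val_inj; rewrite /= gact1. Qed.

Let sactM g h x : sact (g * h)%g x = sact g (sact h x).
Proof. by apply: val_inj; rewrite /= gactM. Qed.

Definition gsub : gset G := GSet sact1 sactM.

End Subobject.

Definition gkernel (G : groupType) (A : gset G) : set G :=
  [set g | forall x : A, gact g x = x].

(* The supremum starts at the zeroth iterate, i.e. at card M itself. *)
Definition chi (G : groupType) (M : gset G) : Type :=
  card_sup (fun n => gpower_iter n M).

(* Main.v *)
Require Import Defs.
From mathcomp Require Import all_boot.
From mathcomp Require Import boolp classical_sets functions cardinality.
From mathcomp Require Import wochoice.

(** Elements of [G] that fix [M] pointwise act trivially on every iterated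
    power, hence on its subobjects; with Cantor's theorem this settles the
    direct implication.  For the converse, [card X < chi M] gives a mere
    injection of sets from [X] into some [M_n], and three ideas replace it by
    an equivariant one.

    - Rigidity ([fix_segment_chain]).  Fix a well-order of [M].  An injection
      of [M] sending each segment [seg le m = {y | y <= m}] to such a segment
      is the identity.  Hence the chain [w] of all these segments, an element
      of [P (P M)], is fixed by no element of [G] outside the kernel of [M].

    - Labels ([fixed_labels]).  By rigidity again, the chains
      [segs le (seg le m)], which stop at [m], lie in distinct orbits, so
      these orbits are fixed elements of [P (P (P M))] indexed injectively by
      [m : M].  Taking direct images, each [M_n] injects into the fixed
      elements of some [M_k].

    - Graphs ([embeds_graph]).  If [w] is as above and [l] labels the points
      of [X] by fixed elements, then sending [x] to the set of pairs
      [(u w, l y)] with [u y = x] is an equivariant injection: [w] records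
      [u] modulo the kernel of [M], which acts trivially on [X].  Kuratowski
      pairs keep the construction inside the tower of powers. *)

Set Implicit Arguments.
Unset Strict Implicit.
Unset Printing Implicit Defensive.

Local Open Scope classical_set_scope.
Local Open Scope card_scope.

(** * Cardinals *)

Lemma card_le_inj (T U : Type) :
  [set: T] #<= [set: U] -> exists f : T -> U, injective f.
Proof.
move=> /card_leP[f]; exists (fun x => val (f (to_setT x))) => x y /val_inj fxy.
have : to_setT x = to_setT y by apply: (@inj _ _ _ f); rewrite ?inE.
by move=> /(congr1 val).
Qed.

Lemma cantor_inj (T : Type) (f : set T -> T) : ~ injective f.
Proof.
move=> fI; pose D := [set f S | S in [set S | ~ S (f S)]].
have [[S NS /fI SD]|ND] := pselect (D (f D)).
  by apply: (NS); rewrite SD; exists S => //; rewrite SD.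
by apply: (ND); exists D.
Qed.

(** Otherwise [T] would be an upper bound of the family, by comparability of
    cardinals, and hence equipotent to the supremum. *)
Lemma card_sup_bound (F : nat -> Type) (T : Type) :
  card_lt T (card_sup F) -> exists n, [set: T] #<= [set: F n].
Proof.
move=> [Tle Tne]; apply: contrapT => /forallNP noF; apply: Tne.
have [_ Fsup] := card_supP F.
rewrite card_eq_le Tle; apply: Fsup => n.
by have [//|/noF] := card_le_or (F n) T.
Qed.

(** * Equivariant embeddings and powers *)

Section GSets.
Variable G : groupType.
Implicit Types (A B C X M : gset G) (g h u : G).

Lemma gactK A g : cancel (@gact G A g) (gact g^-1%g).
Proof. by move=> x; rewrite -gactM mulVg gact1. Qed.

Lemma gact_inj A g : injective (@gact G A g).
Proof. exact: can_inj (@gactK A g). Qed.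

Definition embeds A B := exists f : A -> B, equivariant f /\ injective f.

Lemma embeds_refl A : embeds A A.
Proof. by exists id; split=> [g x|x y]. Qed.

Lemma embeds_trans A B C : embeds A B -> embeds B C -> embeds A C.
Proof.
move=> [f [fE fI]] [h [hE hI]]; exists (h \o f); split; last exact: inj_comp.
by move=> g x; rewrite /= fE hE.
Qed.

Lemma embeds_power A : embeds A (gpower A).
Proof.
exists (fun x => [set x]); split; first by move=> g x; rewrite /= image_set1.
by move=> x y /seteqP[/(_ x erefl)].
Qed.

Lemma embeds_iter M m n :
  m <= n -> embeds (gpower_iter m M) (gpower_iter n M).
Proof.
elim: n => [|n IHn].
  by rewrite leqn0 => /eqP->; exact: embeds_refl.
rewrite leq_eqVlt => /predU1P[->|/IHn mn]; first exact: embeds_refl.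
exact: embeds_trans mn (embeds_power _).
Qed.

Lemma gsub_embeds X A :
  (exists (S : set A) (Sinv : ginvariant S), gset_iso X (gsub Sinv)) <->
  embeds X A.
Proof.
split=> [[S [Sinv [f [f' [fE _ ff' _]]]]]|[f [fE fI]]].
  exists (fun x => val (f x)); split; first by move=> g x; rewrite fE.
  exact: inj_comp val_inj (can_inj ff').
have Rinv : ginvariant (range f).
  by move=> g _ [x _ <-]; exists (gact g x); rewrite ?fE.
exists (range f), Rinv.
pose k x : gsub Rinv := SigSub (mem_set (imageT f x)).
have kE : equivariant k by move=> g x; apply: val_inj; rewrite /= fE.
have kI : injective k by move=> x y /(congr1 val) /fI.
have /choice[k' k'K] : forall y, exists x, k x = y.
  by move=> y; have [x _ xy] := set_valP y; exists x; apply: val_inj.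
exists k, k'; split=> //; last by move=> x; apply: kI.
by move=> g y; apply: kI; rewrite kE !k'K.
Qed.

Lemma gkernel_power A : gkernel A `<=` gkernel (gpower A).
Proof.
move=> g gA S; apply/seteqP; split=> [_ [x Sx <-]|x Sx]; first by rewrite gA.
by exists x.
Qed.

Lemma gkernel_iter M n : gkernel M `<=` gkernel (gpower_iter n M).
Proof. by elim: n => [//|n IHn]; apply: subset_trans IHn (@gkernel_power _). Qed.

Lemma gkernel_embeds A B : embeds A B -> gkernel B `<=` gkernel A.
Proof. by move=> [f [fE fI]] g gB x; apply: fI; rewrite fE gB. Qed.

Definition gfixed A (x : A) := forall g, gact g x = x.

Definition gorbit A (x : A) : gpower A := range (fun g => gact g x).

Lemma gorbit_fixed A (x : A) : gfixed (gorbit x).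
Proof.
move=> g; apply/seteqP; split=> [_ [_ [h _ <-] <-]|_ [h _ <-]].
  by exists (g * h)%g; rewrite // gactM.
exists (gact (g^-1 * h)%g x); first by exists (g^-1 * h)%g.
by rewrite -gactM mulVKg.
Qed.

Lemma gorbit_eq A (x y : A) : gorbit x = gorbit y -> exists g, gact g x = y.
Proof.
move=> xy; have [] : gorbit x y; first by rewrite xy; exists 1%g; rewrite ?gact1.
by move=> g _ gxy; exists g.
Qed.

(** * Kuratowski pairs *)

Definition kpair A (a b : A) : gpower (gpower A) := [set [set a]; [set a; b]].

Lemma kpair_inj A (a b c d : A) : kpair a b = kpair c d -> a = c /\ b = d.
Proof.
move=> abcd.
have ac : a = c.
  have [] : kpair c d [set a] by rewrite -abcd; left.
    by move=> /seteqP[/(_ a erefl)].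
  by move=> /seteqP[_ /(_ c (or_introl erefl))].
subst c; split=> //.
have sub (b' d' : A) : kpair a b' = kpair a d' -> b' = a \/ b' = d'.
  move=> e; have : kpair a d' [set a; b'] by rewrite -e; right.
  by move=> [] /seteqP[/(_ b' (or_intror erefl))]; [left|].
by have [|//] := sub _ _ abcd; have [|//] := sub _ _ (esym abcd); move=> -> ->.
Qed.

Lemma gact_kpair A g (a b : A) : gact g (kpair a b) = kpair (gact g a) (gact g b).
Proof. by rewrite /kpair /= image_setU !image_set1 /= image_setU !image_set1. Qed.

(** Translating [x] by [g] turns [u y = x] into [(g u) y = g x] and leaves the
    label of [y] alone, whence equivariance.  The pair [(w, l x)] belongs to
    the image of [x]; if it also belongs to the image of [x'], then [u y = x']
    for some [u] fixing [w] and some [y] with the label of [x], so that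
    [x' = u x = x]. *)
Lemma embeds_graph X A (w : A) (l : X -> A) :
  (forall g, gact g w = w -> gkernel X g) ->
  injective l -> (forall x, gfixed (l x)) ->
  embeds X (gpower (gpower (gpower A))).
Proof.
move=> wX lI lF.
pose graph x : gpower (gpower (gpower A)) :=
  [set kpair (gact p.1 w) (l p.2) | p in [set p : G * X | gact p.1 p.2 = x]].
exists graph; split=> [g x|x x' xx'].
  apply/seteqP; split=> [_ [[u y] /= uy <-]|_ [_ [[u y] /= uy <-] <-]].
    exists (kpair (gact (g^-1 * u)%g w) (l y)).
      by exists ((g^-1 * u)%g, y); rewrite //= gactM uy gactK.
    by rewrite -[LHS]/(gact g (kpair _ _)) gact_kpair lF -gactM mulVKg.
  exists ((g * u)%g, y); first by rewrite /= gactM uy.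
  by rewrite -[RHS]/(gact g (kpair _ _)) gact_kpair lF gactM.
have : graph x (kpair w (l x)) by exists (1%g, x); rewrite /= gact1.
rewrite xx' => -[[u y] /= uy /kpair_inj[uw /lI yx]].
by rewrite -yx -uy (wX u uw).
Qed.

End GSets.

(** * Rigidity of well-orders *)

Section WellOrder.
Variables (T : Type) (le : T -> T -> Prop).

Definition is_wo :=
  [/\ forall x y, le x y \/ le y x,
      forall x y, le x y -> le y x -> x = y,
      forall x y z, le x y -> le y z -> le x z &
      forall S : set T, S !=set0 -> exists2 x, S x & forall y, S y -> le x y].

Definition seg (x : T) : set T := [set y | le y x].

Definition segs (S : set T) : set (set T) := [set seg x | x in S].

Hypothesis le_wo : is_wo.

Lemma wo_refl x : le x x.
Proof. by case: le_wo => tot _ _ _; case: (tot x x). Qed.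

Lemma seg_le x y : seg x = seg y -> le x y.
Proof. by move=> xy; have : seg x x := wo_refl x; rewrite xy. Qed.

(** Let [x0] be the least moved point.  Points below [x0] are the values of
    themselves, so [f x0] is not one of them.  Hence [x0] is below [f x0] and
    belongs to the segment [f @` seg x0]; but only [x0] could be sent to
    [x0]. *)
Lemma fix_segment_chain (f : T -> T) (S : set T) :
  injective f -> (forall x y, le x y -> S y -> S x) ->
  (forall x, S x -> exists z, f @` seg x = seg z) ->
  forall x, S x -> f x = x.
Proof.
case: le_wo => tot anti trans wf fI Sdown fS x Sx; apply: contrapT => fx.
have [|x0 [Sx0 fx0] x0min] := wf [set x | S x /\ f x <> x]; first by exists x.
have below y : le y x0 -> y <> x0 -> f y = y.
  move=> yx0 ney; apply: contrapT => fy; apply: ney.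
  by apply: anti => //; apply: x0min; split=> //; exact: Sdown Sx0.
have [x0f|fx0le] := tot x0 (f x0); last first.
  by apply: (fx0); apply: fI; exact: below.
have [z fz] := fS _ Sx0.
have zfx0 : seg z (f x0) by rewrite -fz; exists x0 => //; exact: wo_refl.
have : seg z x0 := trans _ _ _ x0f zfx0.
rewrite -fz => -[y yx0 fy]; have [yE|/(below _ yx0) fyy] := pselect (y = x0).
  by apply: fx0; rewrite -{1}yE.
by apply: fx0; rewrite -fy fyy.
Qed.

End WellOrder.

Lemma wo_exists (T : Type) : exists le : T -> T -> Prop, is_wo le.
Proof.
have [R Rwo] := well_ordering_principle {classic T}.
have Rchain : wo_chain R predT by move=> S _; exact: Rwo.
have tot (x y : T) : R x y \/ R y x by apply/orP; exact: (wo_chainW Rchain).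
have anti : antisymmetric R.
  by move=> x y; exact: (wo_chain_antisymmetric Rchain).
have min (S : set T) :
    S !=set0 -> exists2 x, S x & forall y, S y -> R x y.
  move=> [x0 Sx0]; pose b : {pred {classic T}} := fun x => `[< S x >].
  have [|x [[/asboolP Sx xmin] _]] := Rwo b.
    by exists x0; apply/asboolP.
  by exists x => // y Sy; apply: xmin; apply/asboolP.
exists (fun x y => R x y); split=> //.
  by move=> x y xy yx; apply: anti; apply/andP.
move=> x y z xy yz.
(* Transitivity comes from the minimum of the three points. *)
have [|t tS tmin] := min [set x; y; z]; first by exists x; left; left.
have [tx ty tz] : [/\ R t x, R t y & R t z].
  by split; apply: tmin; [left; left|left; right|right].
case: tS => [[]|] /= e; subst t => //.
  by have -> : x = y by apply: anti; rewrite xy tx.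
by have <- : y = z by apply: anti; rewrite yz ty.
Qed.

(** * Rigid elements and fixed labels in the tower of powers *)

Section Tower.
Variable G : groupType.
Implicit Type M : gset G.

(** The element is the chain of all segments of a well-order of [M]. *)
Lemma rigid_element M :
  exists w : gpower_iter 2 M, forall g, gact g w = w -> gkernel M g.
Proof.
have [le le_wo] := wo_exists M.
exists (segs le setT) => g gw x.
apply: (fix_segment_chain le_wo (@gact_inj _ M g) (S := setT)) => // y _.
have : segs le setT (gact (g0 := gpower M) g (seg le y)).
  by rewrite -[X in X _]gw; exists (seg le y) => //; exists y.
by move=> [z _ zy]; exists z; exact: esym zy.
Qed.

(** If [g] carries the chain stopping at [m] to the one stopping at [m'], it
    fixes every point up to [m] by rigidity, so [seg le m] itself is a member
    of the second chain: [m] lies below [m'].  Being in the same orbit is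
    symmetric, so [m = m']. *)
Lemma fixed_labels0 M :
  exists l : M -> gpower_iter 3 M, injective l /\ forall m, gfixed (l m).
Proof.
have [le le_wo] := wo_exists M.
have [_ anti trans _] := le_wo.
pose c m : gpower (gpower M) := segs le (seg le m).
exists (fun m => gorbit (c m)); split; last by move=> m; exact: gorbit_fixed.
have c_le m m' : gorbit (c m) = gorbit (c m') -> le m m'.
  move=> /gorbit_eq[g gc].
  have gseg x : le x m -> exists2 z, le z m' & gact g @` seg le x = seg le z.
    move=> xm; have : c m' (gact (g0 := gpower M) g (seg le x)).
      by rewrite -gc; exists (seg le x) => //; exists x.
    by move=> [z zm' zx]; exists z => //; exact: esym zx.
  have fixm x : le x m -> gact g x = x.
    apply: (fix_segment_chain le_wo (@gact_inj _ M g) (S := seg le m)).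
      by move=> {}x y; exact: trans.
    by move=> y /gseg[z _ yz]; exists z.
  have [z zm' mz] := gseg m (wo_refl le_wo m).
  apply: trans zm'; apply: (seg_le le_wo); rewrite -mz.
  apply/seteqP; split=> [x xm|_ [x xm <-]]; last by rewrite fixm.
  by exists x; rewrite ?fixm.
by move=> m m' e; apply: anti; apply: c_le.
Qed.

Lemma fixed_labels M n :
  exists k (l : gpower_iter n M -> gpower_iter k M),
    injective l /\ forall x, gfixed (l x).
Proof.
elim: n => [|n [k [l [lI lF]]]].
  by have [l lP] := fixed_labels0 M; exists 3, l.
exists k.+1, (fun S : set _ => l @` S); split=> [S S' SS'|S g].
  by apply/funext => x; rewrite -(image_inj lI) SS' image_inj.
apply/seteqP; split=> [_ [_ [x Sx <-] <-]|_ [x Sx <-]].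
  by exists x; rewrite ?lF.
by exists (l x); [exists x | rewrite lF].
Qed.

End Tower.

(** * The characterization *)

Section Characterization.
Variables (G : groupType) (M X : gset G).

Lemma embeds_card_lt n : embeds X (gpower_iter n M) -> card_lt X (chi M).
Proof.
move=> [f [_ fI]]; have XM := inj_card_leT fI.
have [chi_ub _] := card_supP (fun n => gpower_iter n M).
split; first exact: card_le_trans XM (chi_ub n).
rewrite card_eq_le => /andP[_ chiX].
have /card_le_inj[h] := card_le_trans (chi_ub n.+1) (card_le_trans chiX XM).
exact: cantor_inj.
Qed.

Lemma card_lt_embeds :
  card_lt X (chi M) -> gkernel M `<=` gkernel X ->
  exists n, embeds X (gpower_iter n.+1 M).
Proof.
move=> /card_sup_bound[n /card_le_inj[f fI]] MX.
have [k [l [lI lF]]] := fixed_labels M n.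
have [w wM] := rigid_element M.
(* The rigid element and the labels are brought to a common level. *)
have [e2 [e2E e2I]] := embeds_iter M (leq_maxl 2 k).
have [ek [ekE ekI]] := embeds_iter M (leq_maxr 2 k).
exists (maxn 2 k).+2; apply: (@embeds_graph _ _ _ (e2 w) (ek \o l \o f)).
- by move=> g; rewrite -e2E => /e2I /wM /MX.
- by apply: inj_comp fI; exact: inj_comp.
- by move=> x g; rewrite /= -ekE lF.
Qed.

End Characterization.

Theorem mainTheorem1 (G : groupType) (M X : gset G) :
  (exists (n : nat) (S : set (gpower_iter n M)) (Sinv : ginvariant S),
     (1 <= n)%N /\ gset_iso X (gsub Sinv)) <->
  card_lt X (chi M) /\ (gkernel M `<=` gkernel X)%classic.
Proof.
split=> [[n [S [Sinv [_ Xiso]]]]|[Xlt MX]].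
  have XM : embeds X (gpower_iter n M) by apply/gsub_embeds; exists S, Sinv.
  split; first exact: embeds_card_lt XM.
  exact: subset_trans (@gkernel_iter _ M n) (gkernel_embeds XM).
have [n /gsub_embeds[S [Sinv Xiso]]] := card_lt_embeds Xlt MX.
by exists n.+1, S, Sinv.
Qed.
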